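(* Let $d \geq 1$ be an integer and let $0 \leq \beta < 1$. For every $C$ there exist $M$ and $c > 0$ such that the following holds. Let $F$ be a finite field with $|F| \geq M$, let $n$ be a positive integer, and let $\mathbf{L}$ be a collection (set) of lines in $F^n$ with $|\mathbf{L}| \geq |F|^{2(d-1)+\beta}$ such that, setting $\mathbf{P} := \bigcup_{L \in \mathbf{L}} L$, $$|\mathbf{P}| \leq C\,|F|^{d+\beta}.$$ Then there are distinct $d$-planes $R_1, \ldots, R_N$ in $F^n$ with $N \geq c\,|F|^{\beta}$ such that $$\Big|\mathbf{P} \cap \bigcup_{j=1}^N R_j\Big| \geq c\,|\mathbf{P}|$$ and, for each $j$, $$|\mathbf{P} \cap R_j| \geq c\,|R_j|.$$
   Context: $|\cdot|$ denotes cardinality. A $k$-plane in $F^n$ is a translate of a $k$-dimensional linear subspace of $F^n$, regarded as a set of points; a line is a $1$-plane. *)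

(* Defs.v *)
From HB Require Import structures.
From mathcomp Require Import all_boot all_order all_algebra.
From mathcomp Require Import all_classical all_reals all_analysis.

Set Implicit Arguments.
Unset Strict Implicit.
Unset Printing Implicit Defensive.

Import Order.TTheory GRing.Theory Num.Theory.

Local Open Scope ring_scope.

(* The space F^n is the type 'rV[F]_n of row vectors, and planes are its
   finite subsets (finset's {set _}, so that #|_| is the cardinality). *)
Definition is_plane (F : finFieldType) (n k : nat) (A : {set 'rV[F]_n}) : Prop :=
  exists (v : 'rV[F]_n) (U : {vspace 'rV[F]_n}),
    \dim U = k /\ A = [set v + u | u in U]%SET.

Definition is_line (F : finFieldType) (n : nat) (A : {set 'rV[F]_n}) : Prop :=
  is_plane 1 A.

(* Main.v *)
Require Import Defs.
From HB Require Import structures.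
From mathcomp Require Import all_boot all_order all_algebra.
From mathcomp Require Import all_classical all_reals all_analysis.
From mathcomp Require Import finfield.
From mathcomp Require Import zify ring lra.

Set Implicit Arguments.
Unset Strict Implicit.
Unset Printing Implicit Defensive.

Import Order.TTheory GRing.Theory Num.Theory.

Local Open Scope ring_scope.

(** Write q = |F|.  The idea is to grow planes around typical lines, one
    dimension at a time, until d-planes filled to a positive proportion by P
    are reached.

    The union P is so small that an average point of P lies on about q^(d-1)
    lines of L.  [prune_incidences] passes to a set A of at least half of the
    lines and a set B of points of P such that every line of A has about q/2
    of its points in B and every point of B lies on a >~ q^(d-1) lines of A.
    Suppose that a k-plane X with k < d meets B in at least q^k/8 points.
    Fewer than 2 q^(k-1) lines through a given point lie in X, so about
    a q^k >~ q^(d+k-1) lines of A cross X at a point of B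
    ([card_transversal_lines]).  Sort them by the (k+1)-plane that each spans
    with X; these (k+1)-planes are disjoint outside X.  If a (k+1)-plane Y has
    at most q^(k+1)/8 points of B, the second moment over the pairs of points
    of Y ([incidence_bound]) shows that Y contains only O(q^(k-2) |B /\ Y|)
    lines rich in B.  Were this so for all Y, summing over Y would give at most
    O(q^(k-2) |P|) = O(q^(d+k-2+beta)) crossing lines, which is too few for
    large q because beta < 1.  So some Y is rich ([extend_rich_plane]), and
    since X lies in Y, induction puts every line of A in a d-plane Y with
    |P /\ Y| >= q^d/8 ([lines_in_rich_planes]).

    The rich d-planes are the R_j.  Each contains at most 2 q^(2(d-1)) lines,
    so covering A takes N >~ q^beta of them ([many_planes]).  Distinct d-planes
    share at most q^(d-1) points, so Cauchy-Schwarz gives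
    |P /\ (R_1 \/ ... \/ R_N)| >~ N q^(d+1) / (q + N) >~ q^(d+beta) >~ |P|
    ([card_union_planes]). *)

(** * Affine planes over a finite field *)

Section Planes.
Import mathcomp.boot.fintype mathcomp.boot.finset.
Variables (F : finFieldType) (n : nat).
Local Notation V := 'rV[F]_n.
Local Notation q := #|F|.
Implicit Types (x y z v : V) (l X Y : {set V}) (U W : {vspace V}).

Lemma card_field_gt1 : (1 < q)%N.
Proof. exact: finRing_gt1. Qed.

(** A plane is the translate of its direction space by any of its points, not
    only by the base point that witnesses [is_plane]. *)
Lemma plane_at k X x : is_plane k X -> x \in X ->
  exists2 U, \dim U = k & forall y, (y \in X) = (y - x \in U).
Proof.
move=> [v [U [dU ->]]] /imsetP[u0 u0U ->]; exists U => // y.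
apply/imsetP/idP => [[u uU ->]|yU].
  by rewrite opprD addrACA subrr add0r rpredB.
exists (y - v); last by rewrite addrC subrK.
by rewrite -[y - v](subrK u0) rpredD // -addrA -opprD.
Qed.

Lemma card_plane k X : is_plane k X -> #|X| = (q ^ k)%N.
Proof.
move=> [v [U [<- ->]]]; rewrite card_imset; last exact: addrI.
by rewrite card_vspace.
Qed.

Lemma plane_nonempty k X : is_plane k X -> exists x, x \in X.
Proof.
move=> /card_plane cX; apply/set0Pn; rewrite -card_gt0 cX expn_gt0.
by rewrite (ltnW card_field_gt1).
Qed.

Lemma plane_closed k X x y z (t : F) : is_plane k X ->
  x \in X -> y \in X -> z \in X -> x + t *: (y - z) \in X.
Proof.
move=> pX xX yX zX; have [U _ XU] := plane_at pX xX.
rewrite XU addrAC subrr add0r rpredZ //.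
have -> : y - z = (y - x) - (z - x) by rewrite opprB addrA subrK.
by rewrite rpredB // -XU.
Qed.

Lemma line_two_points l x y : is_line l -> x \in l -> y \in l -> x != y ->
  l = [set x + t *: (y - x) | t : F].
Proof.
move=> ll xl yl nxy; have [U dU lU] := plane_at ll xl.
have UE : U = <[y - x]>%VS.
  apply/esym/eqP; rewrite eqEdim dim_vline subr_eq0 eq_sym nxy dU leqnn andbT.
  by rewrite -memvE -lU.
apply/setP=> z; rewrite lU UE; apply/vlineP/imsetP => [[t zE]|[t _ ->]].
  by exists t => //; rewrite -zE addrC subrK.
by exists t; rewrite addrAC subrr add0r.
Qed.

Lemma line_uniq l l' x y : is_line l -> is_line l' ->
  x \in l -> y \in l -> x \in l' -> y \in l' -> x != y -> l = l'.
Proof.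
move=> ll ll' xl yl xl' yl' nxy.
by rewrite (line_two_points ll xl yl nxy) (line_two_points ll' xl' yl' nxy).
Qed.

Lemma line_sub_plane k l X x y : is_line l -> is_plane k X ->
  x \in l -> y \in l -> x \in X -> y \in X -> x != y -> l \subset X.
Proof.
move=> ll pX xl yl xX yX nxy; rewrite (line_two_points ll xl yl nxy).
by apply/subsetP=> _ /imsetP[t _ ->]; apply: plane_closed pX _ _ _.
Qed.

(** The affine hull of X and l when the two meet.  It is written as an
    expression in the sets alone, without base point or direction space, so
    that lines can be sorted by the value of [join X]. *)
Definition join X l : {set V} := [set x + (y.1 - y.2) | x in X, y in setX l l].

Lemma join_plane k X l x : is_plane k X -> is_line l -> x \in X -> x \in l ->
  ~~ (l \subset X) ->
  [/\ is_plane k.+1 (join X l), X \subset join X l & l \subset join X l].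
Proof.
move=> pX ll xX xl nlX.
have [U dU XU] := plane_at pX xX; have [W dW lW] := plane_at ll xl.
have jE y : (y \in join X l) = (y - x \in (U + W)%VS).
  apply/imset2P/memv_addP => [[z [w1 w2] zX /setXP[w1l w2l] -> /=]|[u uU [w wW yE]]].
    exists (z - x); first by rewrite -XU.
    exists (w1 - w2); last by rewrite addrAC.
    have -> : w1 - w2 = (w1 - x) - (w2 - x) by rewrite opprB addrA subrK.
    by rewrite rpredB // -lW.
  (* The required point is x + u + w: the point x + u of X plus the difference
     of the points x + w and x of l. *)
  exists (x + u) (x + w, x) => /=.
  - by rewrite XU addrAC subrr add0r.
  - by rewrite inE /= xl lW addrAC subrr add0r wW.
  - by rewrite [x + w]addrC addrK -addrA -yE addrC subrK.
split; last 2 first.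
- by apply/subsetP=> y yX; rewrite jE (subvP (addvSl U W)) // -XU.
- by apply/subsetP=> y yX; rewrite jE (subvP (addvSr U W)) // -lW.
exists x, (U + W)%VS; split; last first.
  apply/setP=> y; rewrite jE; apply/idP/imsetP => [yUW|[u uUW ->]].
    by exists (y - x) => //; rewrite addrC subrK.
  by rewrite addrAC subrr add0r.
rewrite dimv_disjoint_sum ?dU ?dW ?addn1 //; apply/eqP; rewrite -subv0.
apply/subvP => w; rewrite memv_cap memv0 => /andP[wU wW].
apply/negPn/negP => nw; case/negP: nlX.
apply: (line_sub_plane (x := x) (y := x + w) ll pX) => //.
- by rewrite lW addrAC subrr add0r.
- by rewrite XU addrAC subrr add0r.
- by rewrite -subr_eq0 opprD addrA subrr add0r oppr_eq0.
Qed.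

(** A (k+1)-plane through the k-plane X is the hull of X and any one of its
    points outside X, so two of them cannot meet outside X. *)
Lemma plane_ext_uniq k X Y Y' p : is_plane k X -> is_plane k.+1 Y ->
  is_plane k.+1 Y' -> X \subset Y -> X \subset Y' -> p \notin X ->
  p \in Y -> p \in Y' -> Y = Y'.
Proof.
move=> pX pY pY' XY XY' pnX pinY pinY'.
have [x xX] := plane_nonempty pX; have [U dU XU] := plane_at pX xX.
have key Z : is_plane k.+1 Z -> X \subset Z -> p \in Z ->
    forall y, (y \in Z) = (y - x \in (U + <[p - x]>)%VS).
  move=> pZ XZ pinZ y.
  have [W dW ZW] := plane_at pZ (subsetP XZ _ xX).
  have pxU : p - x \notin U by rewrite -XU.
  suff -> : (U + <[p - x]>)%VS = W by [].
  apply/eqP; rewrite eqEdim dW subv_add -memvE -ZW pinZ andbT.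
  apply/andP; split.
    apply/subvP=> u uU; have : x + u \in Z.
      by apply: (subsetP XZ); rewrite XU addrAC subrr add0r.
    by rewrite ZW addrAC subrr add0r.
  rewrite dimv_disjoint_sum; last first.
    apply/eqP; rewrite -subv0; apply/subvP => w.
    rewrite memv_cap memv0 => /andP[wU /vlineP[t wE]].
    rewrite wE scaler_eq0; case: eqVneq => //= tn0; case/negP: pxU.
    by rewrite -[p - x](scalerK tn0) -wE rpredZ.
  by rewrite dU dim_vline subr_eq0 (memPnC pnX) // addn1.
by apply/setP=> y; rewrite (key _ pY) // (key _ pY').
Qed.

Lemma card_planeI k X Y : is_plane k X -> is_plane k Y -> X != Y ->
  (q * #|X :&: Y| <= q ^ k)%N.
Proof.
move=> pX pY nXY; case: (set_0Vmem (X :&: Y)) => [->|[x /setIP[xX xY]]].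
  by rewrite cards0 muln0.
have [U dU XU] := plane_at pX xX; have [W dW YW] := plane_at pY xY.
have IE : X :&: Y = [set x + u | u in (U :&: W)%VS].
  apply/setP=> y; rewrite inE XU YW -memv_cap; apply/idP/imsetP => [yUW|[u uUW ->]].
    by exists (y - x) => //; rewrite addrC subrK.
  by rewrite addrAC subrr add0r.
rewrite IE card_imset; last exact: addrI.
rewrite card_vspace -expnS leq_pexp2l ?(ltnW card_field_gt1) //.
rewrite ltn_neqAle -{2}dU dimvS ?capvSl // andbT; apply/eqP => dUW.
case/eqP: nXY; apply/setP=> y; rewrite XU YW.
have /eqP -> : (U == W) ; last by [].
have /eqP UI : (U :&: W)%VS == U by rewrite eqEdim capvSl dU dUW /=.
by rewrite eqEdim dU dW leqnn andbT -UI capvSr.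
Qed.

End Planes.

(** * Counting in finite sets *)

Section Counting.
Import mathcomp.boot.fintype mathcomp.boot.finset.

Lemma sum_card_disjoint (I T : finType) (A : {set I}) (G : I -> {set T})
    (E : {set T}) :
  {in A, forall i, G i \subset E} ->
  {in A &, forall i j x, x \in G i -> x \in G j -> i = j} ->
  (\sum_(i in A) #|G i| <= #|E|)%N.
Proof.
move=> GE Gdis.
have -> : (\sum_(i in A) #|G i| = \sum_(i in A) \sum_(x in E) (x \in G i))%N.
  apply: eq_bigr => i iA; rewrite -sum1_card big_mkcond /=.
  rewrite [RHS]big_mkcond /=; apply: eq_bigr => x _.
  case: (boolP (x \in G i)) => xG; last by rewrite if_same.
  by rewrite (subsetP (GE i iA)).
rewrite exchange_big -sum1_card /=; apply: leq_sum => x xE.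
have [/existsP[i /andP[iA xi]]|/existsPn no] :=
  boolP [exists i, (i \in A) && (x \in G i)].
  rewrite (bigD1 i) //= xi big1 // => j /andP[jA nji].
  case: (boolP (x \in G j)) => // xj.
  by rewrite (Gdis i j iA jA x xi xj) eqxx in nji.
rewrite big1 // => i iA; move: (no i); rewrite iA /=.
by case: (x \in G i).
Qed.

Lemma cauchy_schwarz_nat (T : finType) (E : {set T}) (m : T -> nat) :
  ((\sum_(x in E) m x) ^ 2 <= #|E| * \sum_(x in E) m x ^ 2)%N.
Proof.
rewrite -(leq_pmul2l (isT : 0 < 2)%N).
have -> : ((\sum_(x in E) m x) ^ 2 =
  \sum_(x in E) \sum_(y in E) m x * m y)%N.
  by rewrite -mulnn big_distrl /=; apply: eq_bigr => x _; rewrite big_distrr.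
have -> : (2 * (#|E| * \sum_(x in E) m x ^ 2) =
  \sum_(x in E) \sum_(y in E) (m x ^ 2 + m y ^ 2))%N.
  under [RHS]eq_bigr => x _ do rewrite big_split /= sum_nat_const.
  by rewrite big_split /= -big_distrr /= sum_nat_const addnn -mul2n.
rewrite big_distrr; apply: leq_sum => x _.
by rewrite big_distrr; apply: leq_sum => y _; exact: nat_Cauchy.
Qed.

(** Choose A and B so as to maximise I(A, B) + a |P \ B| + b |L \ A|, where I
    counts incidences.  Deleting a line with fewer than b incidences, or a
    point with fewer than a, would increase this quantity, so a maximiser has
    none; and it is at least as good as the pair (L, P), which is the last
    conclusion. *)
Lemma prune_incidences (S T : finType) (r : S -> T -> bool)
    (L : {set S}) (P : {set T}) (a b : nat) :
  exists (A : {set S}) (B : {set T}),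
    [/\ A \subset L, B \subset P,
        {in A, forall l, (b <= #|[set x in B | r l x]|)%N},
        {in B, forall x, (a <= #|[set l in A | r l x]|)%N}
      & (\sum_(l in L) #|[set x in P | r l x]| <=
         \sum_(l in A) #|[set x in B | r l x]|
           + a * #|P :\: B| + b * #|L :\: A|)%N].
Proof.
pose I (A : {set S}) (B : {set T}) := (\sum_(l in A) #|[set x in B | r l x]|)%N.
have IE A B : I A B = (\sum_(x in B) #|[set l in A | r l x]|)%N.
  rewrite /I; transitivity (\sum_(l in A) \sum_(x in B) r l x)%N.
    apply: eq_bigr => l _; rewrite -sum1dep_card big_mkcondr /=.
    by apply: eq_bigr => x _; case: (r l x).
  rewrite exchange_big /=; apply: eq_bigr => x _.
  rewrite -[RHS]sum1dep_card big_mkcondr /=.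
  by apply: eq_bigr => l _; case: (r l x).
pose phi (p : {set S} * {set T}) :=
  (I p.1 p.2 + a * #|P :\: p.2| + b * #|L :\: p.1|)%N.
pose ok (p : {set S} * {set T}) := (p.1 \subset L) && (p.2 \subset P).
have ok0 : ok (L, P) by rewrite /ok /= !subxx.
case: (@arg_maxnP _ (L, P) ok phi ok0) => -[A B] /andP[/= AL BP] Amax.
exists A, B; split => //.
- move=> l lA; rewrite leqNgt; apply/negP => small.
  have : (phi (A :\ l, B) <= phi (A, B))%N.
    by apply: Amax; rewrite /ok /= BP andbT (subset_trans _ AL) ?subsetDl.
  rewrite leqNgt => /negP; apply; rewrite /phi /= /I.
  rewrite (big_setD1 l lA) /=.
  have -> : L :\: (A :\ l) = l |: (L :\: A).
    apply/setP=> z; rewrite !inE; case: eqVneq => //= -> .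
    by rewrite (subsetP AL).
  by rewrite cardsU1 !inE lA /= mulnDr muln1; lia.
- move=> x xB; rewrite leqNgt; apply/negP => small.
  have : (phi (A, B :\ x) <= phi (A, B))%N.
    by apply: Amax; rewrite /ok /= AL (subset_trans _ BP) ?subsetDl.
  rewrite leqNgt => /negP; apply; rewrite /phi /= !IE.
  rewrite (big_setD1 x xB) /=.
  have -> : P :\: (B :\ x) = x |: (P :\: B).
    apply/setP=> z; rewrite !inE; case: eqVneq => //= -> .
    by rewrite (subsetP BP).
  by rewrite cardsU1 !inE xB /= mulnDr muln1; lia.
- have := Amax (L, P) ok0; rewrite /phi /= !setDv !cards0 !muln0 !addn0.
  by rewrite -/(I L P).
Qed.

End Counting.

(** * Lines in a plane that are rich in a sparse set *)

Section Lines.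
Import mathcomp.boot.fintype mathcomp.boot.finset.
Variables (F : finFieldType) (n : nat).
Local Notation V := 'rV[F]_n.
Local Notation q := #|F|.
Implicit Types (x y z v : V) (l X Y S : {set V}) (Ls : {set {set V}}).

(** Two points determine a line, so the sets of ordered pairs of distinct points
    of different lines are disjoint. *)
Lemma card_lines_pairs Ls (E : {set V * V}) :
  {in Ls, forall l, is_line l} ->
  {in Ls, forall l x y, x \in l -> y \in l -> x != y -> (x, y) \in E} ->
  (#|Ls| * (q * q.-1) <= #|E|)%N.
Proof.
move=> Lsl LsE.
pose G l := [set p : V * V | [&& p.1 \in l, p.2 \in l & p.1 != p.2]].
have GE : {in Ls, forall l, G l \subset E}.
  move=> l lLs; apply/subsetP => -[x y]; rewrite inE /= => /and3P[xl yl nxy].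
  exact: LsE lLs _ _ xl yl nxy.
have Gdis : {in Ls &, forall l l' p, p \in G l -> p \in G l' -> l = l'}.
  move=> l l' lLs l'Ls [x y]; rewrite !inE /= => /and3P[xl yl nxy] /and3P[xl' yl' _].
  by apply: line_uniq (Lsl _ lLs) (Lsl _ l'Ls) xl yl xl' yl' nxy.
apply: leq_trans (sum_card_disjoint GE Gdis).
rewrite -sum_nat_const; apply: leq_sum => l lLs.
have cl : #|l| = q by rewrite (card_plane (Lsl l lLs)) expn1.
have -> : G l = setX l l :\: [set (x, x) | x in l].
  apply/setP=> -[x y]; rewrite !inE /=.
  case: (boolP (x \in l)) => xl; last by rewrite andbF.
  case: (boolP (y \in l)) => yl /=; last by rewrite !andbF.
  rewrite andbT; congr (~~ _); apply/eqP/imsetP => [<-|[z _ [-> ->]]] //.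
  by exists x.
rewrite cardsD cardsX cl (setIidPr _); last first.
  by apply/subsetP=> _ /imsetP[x xl ->]; rewrite inE /= xl.
by rewrite card_imset ?cl; [nia | move=> x y []].
Qed.

(** The lines through x are disjoint outside x. *)
Lemma card_pencil Ls x X :
  {in Ls, forall l, is_line l} -> {in Ls, forall l, x \in l} ->
  {in Ls, forall l, l \subset X} -> (#|Ls| * q.-1 <= #|X|)%N.
Proof.
move=> Lsl Lsx LsX.
have GE : {in Ls, forall l, l :\ x \subset X}.
  by move=> l lLs; rewrite (subset_trans _ (LsX l lLs)) ?subsetDl.
have Gdis : {in Ls &, forall l l' y, y \in l :\ x -> y \in l' :\ x -> l = l'}.
  move=> l l' lLs l'Ls y; rewrite !inE => /andP[nyx yl] /andP[_ yl'].
  rewrite eq_sym in nyx.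
  exact: line_uniq (Lsl _ lLs) (Lsl _ l'Ls) (Lsx _ lLs) yl (Lsx _ l'Ls) yl' nyx.
apply: leq_trans (sum_card_disjoint GE Gdis).
rewrite -sum_nat_const; apply: leq_sum => l lLs.
have := cardsD1 x l; rewrite (card_plane (Lsl l lLs)) expn1 Lsx // => ->.
by rewrite add1n.
Qed.

(** For x != y this is the number of points of S on the line xy
    ([line_countE]).  Counting parameters t instead of points gives a value on
    the diagonal too, and makes both moments over all pairs (x, y) computable
    by changes of variables. *)
Definition line_count S x y : nat := #|[set t : F | x + t *: (y - x) \in S]|.

Lemma line_countE S l x y : is_line l -> x \in l -> y \in l -> x != y ->
  line_count S x y = #|S :&: l|.
Proof.
move=> ll xl yl nxy.
have tinj : injective (fun t : F => x + t *: (y - x)).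
  move=> s t /addrI /eqP; rewrite -subr_eq0 -scalerBl scaler_eq0 !subr_eq0.
  by rewrite [y == x]eq_sym (negPf nxy) orbF => /eqP.
rewrite /line_count -(card_imset _ tinj); congr #|pred_of_set _|.
apply/setP=> z; rewrite inE [in RHS](line_two_points ll xl yl nxy).
apply/imsetP/andP => [[t tS ->]|[zS /imsetP[t _ zE]]].
  by rewrite inE in tS; split=> //; apply/imsetP; exists t.
by exists t => //; rewrite inE -zE.
Qed.

Lemma sum_line_count k X S : is_plane k X -> S \subset X ->
  (\sum_(p in setX X X) line_count S p.1 p.2 = q * (#|X| * #|S|))%N.
Proof.
move=> pX SX.
transitivity (\sum_(p in setX X X) \sum_(t : F) ((p.1 + t *: (p.2 - p.1))%R \in S))%N.
  apply: eq_bigr => p _; rewrite /line_count -sum1dep_card big_mkcond /=.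
  by apply: eq_bigr => t _; case: (_ \in S).
rewrite exchange_big -[RHS]sum_nat_const /=; apply: eq_bigr => t _.
(* Translating both points by u (y - x) keeps y - x, hence is undone by
   translating by - u (y - x); it turns the condition on x + t (y - x) into one
   on the first point alone. *)
pose h (u : F) (p : V * V) := (p.1 + u *: (p.2 - p.1), p.2 + u *: (p.2 - p.1)).
have hK u : cancel (h u) (h (- u)).
  move=> [x y]; rewrite /h /= !opprD addrACA subrr addr0 !scaleNr.
  by rewrite -!addrA !subrr !addr0.
have hinj : injective (h t) := can_inj (hK t).
have hX u p : p \in setX X X -> h u p \in setX X X.
  by rewrite !inE => /andP[p1 p2]; rewrite !(plane_closed u pX).
have hXE p : (h t p \in setX X X) = (p \in setX X X).
  apply/idP/idP => [hp|]; last exact: hX.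
  by rewrite -(hK t p) hX.
transitivity (\sum_(p in setX X X) (p.1 \in S))%N.
  rewrite [RHS](reindex_inj hinj) /=.
  by apply: eq_big => [p|p _] //; rewrite hXE.
rewrite mulnC -cardsX -sum1_card [RHS]big_mkcond [LHS]big_mkcond /=.
apply: eq_bigr => -[x y] _; rewrite !inE /=.
case: (boolP (x \in S)) => xS /=; last by rewrite if_same.
by rewrite (subsetP SX).
Qed.

(** For t != s the pair (x + t (y - x), x + s (y - x)) determines (x, y), so
    each of the q (q - 1) off-diagonal terms is at most |S|^2. *)
Lemma sum_line_count_sq k X S : is_plane k X -> S \subset X ->
  (\sum_(p in setX X X) line_count S p.1 p.2 ^ 2 <=
     q * (#|X| * #|S|) + q ^ 2 * #|S| ^ 2)%N.
Proof.
move=> pX SX.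
pose g (t : F) (p : V * V) := p.1 + t *: (p.2 - p.1).
have -> : (\sum_(p in setX X X) line_count S p.1 p.2 ^ 2 =
    \sum_(t : F) \sum_(s : F)
      \sum_(p in setX X X) (g t p \in S) * (g s p \in S))%N.
  transitivity (\sum_(p in setX X X) \sum_(t : F) \sum_(s : F)
      (g t p \in S) * (g s p \in S))%N.
    apply: eq_bigr => p _.
    have -> : line_count S p.1 p.2 = (\sum_(t : F) (g t p \in S))%N.
      rewrite /line_count -sum1dep_card big_mkcond /=.
      by apply: eq_bigr => t _; rewrite /g; case: (_ \in S).
    by rewrite -mulnn big_distrl /=; apply: eq_bigr => t _; rewrite big_distrr.
  by rewrite exchange_big; apply: eq_bigr => t _; rewrite exchange_big.
have diag : (\sum_(t : F) \sum_(p in setX X X) (g t p \in S) =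
             q * (#|X| * #|S|))%N.
  rewrite -(sum_line_count pX SX) exchange_big; apply: eq_bigr => p _.
  rewrite /line_count -sum1dep_card [RHS]big_mkcond /=.
  by apply: eq_bigr => t _; rewrite /g; case: (_ \in S).
have offdiag (t s : F) : t != s ->
    (\sum_(p in setX X X) (g t p \in S) * (g s p \in S) <= #|S| ^ 2)%N.
  move=> nts.
  have ginj : injective (fun p => (g t p, g s p)).
    move=> [x y] [x' y']; rewrite /g /= => -[e1 e2].
    have e3 : y - x = y' - x'.
      apply: (@scalerI _ _ (t - s)); first by rewrite subr_eq0.
      have dif (v w : V) : (t - s) *: w = (v + t *: w) - (v + s *: w).
        by rewrite opprD addrACA subrr add0r -scalerBl.
      by rewrite (dif x) (dif x') e1 e2.
    have e4 : x = x' by move: e1; rewrite e3 => /addIr.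
    by move: e3; rewrite e4 => /addIr ->.
  have -> : (\sum_(p in setX X X) (g t p \in S) * (g s p \in S) =
      #|[set p in setX X X | (g t p \in S) && (g s p \in S)]|)%N.
    rewrite -sum1dep_card big_mkcondr /=; apply: eq_bigr => p _.
    by case: (g t p \in S); case: (g s p \in S).
  rewrite -mulnn -cardsX -(card_imset _ ginj); apply: subset_leq_card.
  by apply/subsetP=> _ /imsetP[p + ->]; rewrite !inE => /andP[_].
rewrite -diag (bigID (fun=> true)) /= [X in (_ + X)%N]big_pred0_eq addn0.
have -> : (q ^ 2 * #|S| ^ 2 = \sum_(t : F) \sum_(s : F) #|S| ^ 2)%N.
  by rewrite !sum_nat_const mulnA mulnn.
rewrite -big_split /=; apply: leq_sum => t _.
rewrite (bigD1 t) //= leq_add //.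
  by apply: leq_sum => p _; case: (_ \in S).
rewrite [leqRHS](bigD1 t) //=; apply: leq_trans (leq_addl _ _).
by apply: leq_sum => s nst; apply: offdiag; rewrite eq_sym.
Qed.

(** The count over a random pair of points of X has mean m = q |S| / |X| <= q/8,
    and the two moments bound its variance by q |S| / |X|.  On a pair of
    distinct points of a line of Ls the count is at least q/4, so it exceeds
    the mean by at least q/8; Chebyshev's inequality bounds the number of such
    pairs, and each line accounts for q (q - 1) of them. *)
Lemma incidence_bound k X S Ls : is_plane k X -> S \subset X ->
  {in Ls, forall l, is_line l} -> {in Ls, forall l, l \subset X} ->
  {in Ls, forall l, (q <= 4 * #|S :&: l|)%N} -> (8 * #|S| <= #|X|)%N ->
  (#|Ls| * q ^ 3 <= 128 * (#|X| * #|S|))%N.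
Proof.
move=> pX SX Lsl LsX LsS sparse.
pose f (p : V * V) := line_count S p.1 p.2.
pose E := [set p in setX X X | (q <= 4 * f p)%N].
have LE : (#|Ls| * (q * q.-1) <= #|E|)%N.
  apply: card_lines_pairs => // l lLs x y xl yl nxy.
  rewrite !inE /= !(subsetP (LsX l lLs)) //= /f /=.
  by rewrite (line_countE _ (Lsl l lLs)) ?LsS.
have qgt1 := card_field_gt1 F.
have Xgt0 : (0 < #|X|)%N by rewrite (card_plane pX) expn_gt0 ltnW.
have n1 := sum_line_count pX SX; have n2 := sum_line_count_sq pX SX.
suff Eq : (#|E| * q <= 64 * (#|X| * #|S|))%N.
  have q2 : (q <= 2 * q.-1)%N by lia.
  have : (#|Ls| * q ^ 2 * q <= #|Ls| * q ^ 2 * (2 * q.-1))%N by rewrite leq_mul2l q2 orbT.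
  have := leq_mul LE (leqnn (2 * q)); rewrite !expnS expn0 !muln1.
  move: Eq; nia.
(* Multiplying the deviation f - q |S| / |X| by |X| keeps it in the integers. *)
pose c : int := #|X|%:Z; pose e : int := (q * #|S|)%:Z.
have var : (\sum_(p in setX X X) (c * (f p)%:Z - e) ^+ 2 <=
            c ^+ 2 * (q * (#|X| * #|S|))%:Z).
  have -> : \sum_(p in setX X X) (c * (f p)%:Z - e) ^+ 2 =
     c ^+ 2 * (\sum_(p in setX X X) f p ^ 2)%N%:Z
     - 2 * c * e * (\sum_(p in setX X X) f p)%N%:Z + c ^+ 2 * e ^+ 2.
    have -> : c ^+ 2 * e ^+ 2 = \sum_(p in setX X X) e ^+ 2.
      by rewrite sumr_const cardsX /c -mulr_natl natz PoszM expr2; congr (_ * _).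
    rewrite !(big_morph Posz PoszD (erefl 0%:Z)) !mulr_sumr -sumrB -big_split /=.
    by apply: eq_bigr => p _; rewrite -mulnn PoszM; ring.
  rewrite n1.
  move: (\sum_(p in setX X X) f p ^ 2)%N n2 => s2 n2.
  have : c ^+ 2 * s2%:Z <= 
         c ^+ 2 * (q * (#|X| * #|S|) + q ^ 2 * #|S| ^ 2)%N%:Z.
    by apply: ler_wpM2l; rewrite ?sqr_ge0 ?lez_nat.
  rewrite PoszD -!mulnn !PoszM /e PoszM /c.
  move: (Posz s2) (Posz #|X|) (Posz #|S|) (Posz q) => cs cX cS cq.
  rewrite -subr_ge0 => h; rewrite -subr_ge0; apply: le_trans h _.
  by rewrite le_eqVlt; apply/orP; left; apply/eqP; ring.
have : c ^+ 2 * (q ^ 2 * #|E|)%N%:Z <= 64 * (c ^+ 2 * (q * (#|X| * #|S|))%:Z).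
  apply: le_trans (ler_wpM2l _ var) => //.
  rewrite (bigID (fun p => (q <= 4 * f p)%N)) /=.
  have tail_ge0 : 0 <= \sum_(p in setX X X | ~~ (q <= 4 * f p)%N)
      (c * (f p)%:Z - e) ^+ 2 by apply: sumr_ge0 => p _; apply: sqr_ge0.
  have main_ge : c ^+ 2 * (q ^ 2 * #|E|)%N%:Z <=
      64 * \sum_(p in setX X X | (q <= 4 * f p)%N) (c * (f p)%:Z - e) ^+ 2.
    have -> : (q ^ 2 * #|E|)%N = (\sum_(p in setX X X | (q <= 4 * f p)%N) q ^ 2)%N.
      rewrite mulnC -sum_nat_const; apply: eq_bigl => p.
      by rewrite inE.
    rewrite (big_morph Posz PoszD (erefl 0%:Z)) !mulr_sumr; apply: ler_sum.
    move=> p /andP[_ qf].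
    have u_ge0 : 0 <= c * q%:Z by rewrite mulr_ge0.
    have ule : c * q%:Z <= 8 * (c * (f p)%:Z - e).
      have h1 : (#|X| * q <= #|X| * (4 * f p))%N by rewrite leq_mul2l qf orbT.
      have h2 : (q * (8 * #|S|) <= q * #|X|)%N by rewrite leq_mul2l sparse orbT.
      by rewrite /c /e; lia.
    have := ler_pM u_ge0 u_ge0 ule ule; rewrite -!expr2 !exprMn -mulnn PoszM.
    by rewrite -expr2.
  by rewrite mulrDr (le_trans main_ge) // lerDl mulr_ge0.
rewrite mulrCA ler_pM2l ?exprn_gt0 ?ltz_nat // -[64]/(Posz 64) -PoszM lez_nat.
by rewrite -mulnn -mulnA mulnCA leq_pmul2l ?(ltnW qgt1) // [(q * _)%N]mulnC.
Qed.

End Lines.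

(** * Rich planes *)

Section RichPlanes.
Import mathcomp.boot.fintype mathcomp.boot.finset.
Variables (F : finFieldType) (n : nat).
Local Notation V := 'rV[F]_n.
Local Notation q := #|F|.
Implicit Types (x y z v : V) (l X Y S B P : {set V}) (A L Ls : {set {set V}}).

(** At most half of the lines of A through a point of X lie in X, by
    [card_pencil] and the lower bound on a; the others meet X only there, so
    they are counted once. *)
Lemma card_transversal_lines k X A B a : is_plane k X ->
  {in A, forall l, is_line l} ->
  {in B, forall x, (a <= #|[set l in A | x \in l]|)%N} ->
  (4 * q ^ k <= a * q)%N ->
  (#|B :&: X| * a <=
     2 * #|[set l in A | ~~ (l \subset X) && (B :&: X :&: l != set0)]|)%N.
Proof.
move=> pX Al Ba ak; set AX := [set l in A | _].
have qgt1 := card_field_gt1 F.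
have half x : x \in B :&: X ->
    (a <= 2 * #|[set l in A | (x \in l) && ~~ (l \subset X)]|)%N.
  move=> /setIP[xB xX].
  pose Lin := [set l in A | (x \in l) && (l \subset X)].
  have inX : (#|Lin| * q.-1 <= #|X|)%N.
    by apply: (@card_pencil _ _ _ x) => l; rewrite inE => /and3P[lA xl lX] //; apply: Al.
  have := Ba x xB.
  rewrite -(cardsID [set l : {set V} | l \subset X] [set l in A | x \in l]).
  have -> : [set l in A | x \in l] :&: [set l : {set V} | l \subset X] = Lin.
    by apply/setP=> l; rewrite !inE andbA.
  have -> : [set l in A | x \in l] :\: [set l : {set V} | l \subset X] =
            [set l in A | (x \in l) && ~~ (l \subset X)].
    by apply/setP=> l; rewrite !inE andbC -andbA.
  rewrite (card_plane pX) in inX => aE.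
  have : (2 * #|Lin| * q <= a * q)%N by apply: leq_trans ak; nia.
  rewrite leq_pmul2r ?(ltnW qgt1) // => twiceLin.
  have aux (u w c : nat) : (c <= u + w -> 2 * u <= c -> c <= 2 * w)%N by lia.
  exact: aux aE twiceLin.
pose G x := [set l in A | (x \in l) && ~~ (l \subset X)].
have GE : {in B :&: X, forall x, G x \subset AX}.
  move=> x xBX; apply/subsetP=> l; rewrite !inE => /and3P[-> xl ->] /=.
  by apply/set0Pn; exists x; rewrite inE xBX.
have Gdis : {in B :&: X &, forall x y l, l \in G x -> l \in G y -> x = y}.
  move=> x y /setIP[_ xX] /setIP[_ yX] l; rewrite !inE => /and3P[lA xl nlX].
  case/and3P=> _ yl _; apply/eqP; apply: contraNT nlX => nxy.
  exact: (line_sub_plane (Al l lA) pX xl yl xX yX nxy).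
rewrite -sum_nat_const; apply: leq_trans (leq_mul (leqnn 2) (sum_card_disjoint GE Gdis)).
by rewrite big_distrr /=; apply: leq_sum => x /half.
Qed.

(** The lines of A that cross X at a point of B number at least a q^k / 16.  If
    no (k+1)-plane through X were rich, [incidence_bound] in each of them,
    applied to the points of B outside X, would bound their number by
    128 q^(k-2) |B|, against a q^2 > 2048 |B|.  Only the points outside X are
    used because there the (k+1)-planes are disjoint; this costs each crossing
    line one point, whence the predecessor in the hypothesis on A. *)
Lemma extend_rich_plane k X A B a : is_plane k X ->
  {in A, forall l, is_line l} ->
  {in A, forall l, (q <= 4 * #|B :&: l|.-1)%N} ->
  {in B, forall x, (a <= #|[set l in A | x \in l]|)%N} ->
  (4 * q ^ k <= a * q)%N -> (2048 * #|B| < a * q ^ 2)%N ->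
  (q ^ k <= 8 * #|B :&: X|)%N ->
  exists Y, [/\ is_plane k.+1 Y, X \subset Y & (q ^ k.+1 <= 8 * #|B :&: Y|)%N].
Proof.
move=> pX Al Aq Ba ak aB richX.
have qgt1 := card_field_gt1 F.
have := card_transversal_lines pX Al Ba ak; set AX := [set l in A | _] => AXge.
have joinP l : l \in AX ->
    [/\ is_plane k.+1 (join X l), X \subset join X l & l \subset join X l].
  rewrite inE => /and3P[lA nlX /set0Pn[x /setIP[/setIP[_ xX] xl]]].
  exact: (join_plane pX (Al l lA) xX xl nlX).
pose R := [set join X l | l in AX].
have RP Y : Y \in R -> is_plane k.+1 Y /\ X \subset Y.
  by case/imsetP=> l /joinP[? ? _] ->.
have [/exists_inP[Y YR rich]|/exists_inPn poor] :=
  boolP [exists Y in R, (q ^ k.+1 <= 8 * #|B :&: Y|)%N].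
  by have [pY XY] := RP Y YR; exists Y.
pose G Y := (B :&: Y) :\: X.
have Rdis : {in R &, forall Y Y' x, x \in G Y -> x \in G Y' -> Y = Y'}.
  move=> Y Y' /RP[pY XY] /RP[pY' XY'] x; rewrite !inE => /andP[nxX /andP[_ xY]].
  by case/and3P=> _ _ xY'; apply: (plane_ext_uniq pX pY pY' XY XY' nxX).
have RB : {in R, forall Y, G Y \subset B}.
  by move=> Y _; rewrite (subset_trans (subsetDl _ _)) ?subsetIl.
have RG := sum_card_disjoint RB Rdis.
have fiber Y : Y \in R ->
    (#|[set l in AX | join X l == Y]| * q ^ 3 <= 128 * (q ^ k.+1 * #|G Y|))%N.
  move=> YR; have [pY XY] := RP Y YR; rewrite -(card_plane pY).
  apply: (incidence_bound pY).
  - by rewrite (subset_trans (subsetDl _ _)) ?subsetIr.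
  - by move=> l; rewrite !inE => /andP[/andP[lA _] _]; apply: Al.
  - by move=> l; rewrite inE => /andP[/joinP[_ _ lj] /eqP <-].
  - move=> l; rewrite inE => /andP[lAX /eqP jE].
    have [_ _ lY] := joinP l lAX; rewrite jE in lY.
    move: lAX; rewrite inE => /and3P[lA nlX /set0Pn[x /setIP[/setIP[_ xX] xl]]].
    apply: leq_trans (Aq l lA) _; rewrite leq_mul2l /=.
    have : (B :&: l) :\ x \subset G Y :&: l.
      apply/subsetP=> y; rewrite !inE => /and3P[nyx yB yl].
      rewrite yB yl (subsetP lY) // !andbT; apply: contraNN nlX => yX.
      rewrite eq_sym in nyx.
      exact: (line_sub_plane (Al l lA) pX xl yl xX yX nyx).
    move=> /subset_leq_card; apply: leq_trans.
    by have := cardsD1 x (B :&: l); case: (x \in _) => ->; rewrite ?add1n ?leq_pred.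
  - rewrite (card_plane pY); have := poor Y YR; rewrite -ltnNge => /ltnW.
    by apply: leq_trans; rewrite leq_mul2l /= subset_leq_card // subsetDl.
have : (#|AX| * q ^ 3 <= 128 * (q ^ k.+1 * #|B|))%N.
  rewrite -sum1_card (partition_big_imset (join X)) /= big_distrl /=.
  apply: (@leq_trans (\sum_(Y in R) 128 * (q ^ k.+1 * #|G Y|))%N).
    apply: leq_sum => Y YR; apply: leq_trans (fiber Y YR).
    by rewrite sum1dep_card.
  by rewrite -!big_distrr /= leq_mul2l leq_mul2l RG !orbT.
move=> AXle; exfalso; move: aB; rewrite ltnNge => /negP; apply.
have q0 : (0 < q ^ k.+1)%N by rewrite expn_gt0 ltnW.
rewrite -(leq_pmul2l q0).
have h1 : (q ^ k * (a * q ^ 3) <= 8 * #|B :&: X| * (a * q ^ 3))%N by rewrite leq_mul2r richX orbT.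
have h2 : (#|B :&: X| * a * q ^ 3 <= 2 * #|AX| * q ^ 3)%N by rewrite leq_mul2r AXge orbT.
have -> : (q ^ k.+1 * (a * q ^ 2) = q ^ k * (a * q ^ 3))%N.
  by rewrite [(q ^ k.+1)%N]expnSr [(q ^ 3)%N]expnSr; ring.
move: h1 h2 AXle.
move: (q ^ k.+1)%N (q ^ k)%N (q ^ 3)%N #|AX| #|B| #|B :&: X| => u w c m b s.
rewrite -!mulnA => h1 h2 h3; apply: leq_trans h1 _.
lia.
Qed.

(** Pruning with a = q |L| / (4 |P|) and b = q/2 deletes at most half of the
    lines.  The two numerical hypotheses say that a >= 4 q^d and that
    a q^2 > 2048 |P|, up to rounding of a: what [extend_rich_plane] needs in
    every dimension below d + 2. *)
Lemma lines_in_rich_planes d (L : {set {set V}}) P :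
  {in L, forall l, is_line l} -> {in L, forall l, l \subset P} ->
  (6 <= q)%N ->
  (16 * (#|P| * q ^ d) <= #|L| * q)%N ->
  ((128 * #|P|) ^ 2 < #|L| * q ^ 3)%N ->
  exists A, [/\ A \subset L, (#|L| <= 2 * #|A|)%N &
    {in A, forall l, exists Y,
      [/\ is_plane d.+2 Y, l \subset Y & (q ^ d.+2 <= 8 * #|P :&: Y|)%N]}].
Proof.
move=> Ll LP q6 hd hP.
have Lgt0 : (0 < #|L|)%N by case: #|L| hP.
have Pgt0 : (0 < #|P|)%N.
  have [l lL] : exists l, l \in L by apply/set0Pn; rewrite -card_gt0.
  have [x xl] := plane_nonempty (Ll l lL).
  by apply/card_gt0P; exists x; apply: (subsetP (LP l lL)).
pose a := ((#|L| * q) %/ (4 * #|P|))%N.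
have aP : (4 * #|P| * a <= #|L| * q)%N by rewrite mulnC leq_trunc_div.
have aP' : (#|L| * q < 4 * #|P| * a.+1)%N.
  by rewrite [ltnRHS]mulnC ltn_ceil // muln_gt0.
have ad : (4 * q ^ d <= a)%N by rewrite leq_divRL ?muln_gt0 //; lia.
have [A [B [AL BP Ab Ba]]] :=
  prune_incidences (fun (l : {set V}) (x : V) => x \in l) L P a q./2.
have inc : (\sum_(l in L) #|[set x in P | x \in l]| = #|L| * q)%N.
  rewrite -sum_nat_const; apply: eq_bigr => l lL.
  have -> : [set x in P | x \in l] = l.
    by apply/setP=> x; rewrite inE andb_idl // => /(subsetP (LP l lL)).
  by rewrite (card_plane (Ll l lL)) expn1.
have incA : (\sum_(l in A) #|[set x in B | x \in l]| <= #|A| * q)%N.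
  rewrite -sum_nat_const; apply: leq_sum => l lA.
  rewrite -[q]expn1 -(card_plane (Ll l (subsetP AL _ lA))).
  by apply/subset_leq_card/subsetP=> x; rewrite inE => /andP[].
rewrite inc => phi.
have LA : (#|L| <= 2 * #|A|)%N.
  have c1 : (a * #|P :\: B| <= a * #|P|)%N.
    by rewrite leq_mul2l subset_leq_card ?orbT // subsetDl.
  have c2 : #|L :\: A| = (#|L| - #|A|)%N by rewrite cardsD (setIidPr AL).
  have c3 := subset_leq_card AL.
  have c4 : (2 * q./2 <= q)%N by rewrite -[leqRHS]odd_double_half mul2n leq_addl.
  rewrite c2 in phi.
  have c5 : (2 * (q./2 * (#|L| - #|A|)) <= q * (#|L| - #|A|))%N.
    by rewrite mulnA leq_mul2r c4 orbT.
  have c6 : (q * (#|L| - #|A|) = #|L| * q - #|A| * q)%N by rewrite mulnBr ![(q * _)%N]mulnC.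
  have c7 : (#|A| * q <= #|L| * q)%N by rewrite leq_mul2r c3 orbT.
  have aux (LQ AQ s u w t r : nat) : (LQ <= s + u + t -> s <= AQ -> u <= w ->
      4 * w <= LQ -> 2 * t <= r -> r = LQ - AQ -> AQ <= LQ -> LQ <= 2 * AQ)%N by lia.
  rewrite -mulnA [(#|P| * a)%N]mulnC in aP.
  have := aux _ _ _ _ _ _ _ phi incA c1 aP c5 c6 c7.
  by rewrite mulnA leq_pmul2r // (leq_trans _ q6).
exists A; split => // l lA.
have Al : {in A, forall l, is_line l} by move=> l' /(subsetP AL) /Ll.
have BE l' : [set x in B | x \in l'] = B :&: l' by apply/setP=> x; rewrite !inE.
have Bl : {in A, forall l, (q./2 <= #|B :&: l|)%N}.
  by move=> l' /Ab; rewrite BE.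
have qh : (q <= q./2.*2.+1)%N by rewrite -{1}(odd_double_half q); case: odd; lia.
have Aq : {in A, forall l, (q <= 4 * #|B :&: l|.-1)%N}.
  by move=> l' /Bl; lia.
have aB : (2048 * #|B| < a * q ^ 2)%N.
  have BP' := subset_leq_card BP.
  rewrite ltnNge; apply/negP => bad.
  have a1 : (0 < a)%N by apply: leq_trans ad; rewrite muln_gt0 expn_gt0; lia.
  have e1 : (#|L| * q * q ^ 2 <= 8 * #|P| * (a * q ^ 2))%N.
    by rewrite mulnA leq_mul2r; apply/orP; right; nia.
  have e2 : (a * q ^ 2 <= 2048 * #|P|)%N.
    by apply: leq_trans bad _; rewrite leq_mul2l BP'.
  have : (8 * #|P| * (a * q ^ 2) <= 8 * #|P| * (2048 * #|P|))%N by rewrite leq_mul2l e2 orbT.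
  move=> e3; move: (leq_trans e1 e3); rewrite leqNgt => /negP; apply.
  by move: hP; rewrite -(mulnA #|L|) -expnS mulnACA mulnn expnMn.
suff rich k : (k <= d.+1)%N -> exists Y,
    [/\ is_plane k.+1 Y, l \subset Y & (q ^ k.+1 <= 8 * #|B :&: Y|)%N].
  have [Y [pY lY rY]] := rich d.+1 (leqnn _).
  exists Y; split => //; apply: leq_trans rY _.
  by rewrite leq_mul2l subset_leq_card // setSI.
elim: k => [|k IHk] kd.
  exists l; split; [exact: Al | exact: subxx |].
  by rewrite expn1; have := Aq l lA; lia.
have [Y [pY lY rY]] := IHk (ltnW kd).
have [|Z [pZ YZ rZ]] := extend_rich_plane pY Al Aq Ba _ aB rY.
  rewrite expnSr mulnA leq_mul2r; apply/orP; right; apply: leq_trans ad.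
  by rewrite leq_mul2l leq_exp2l //; lia.
by exists Z; split => //; apply: subset_trans YZ.
Qed.

(** A d-plane has q^(2d) pairs of points and each line uses at least q^2 / 2 of
    them. *)
Lemma many_planes d (R A : {set {set V}}) :
  {in R, forall Y, is_plane d Y} -> {in A, forall l, is_line l} ->
  {in A, forall l, exists2 Y, Y \in R & l \subset Y} ->
  (#|A| * q ^ 2 <= 2 * (#|R| * q ^ (2 * d)))%N.
Proof.
move=> Rd Al AR; have qgt1 := card_field_gt1 F.
have card_in Y : Y \in R ->
    (#|[set l in A | l \subset Y]| * q ^ 2 <= 2 * q ^ (2 * d))%N.
  move=> YR; have : (#|[set l in A | l \subset Y]| * (q * q.-1) <= #|setX Y Y|)%N.
    apply: card_lines_pairs => l; rewrite inE => /andP[lA lY]; first exact: Al.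
    by move=> x y xl yl _; rewrite inE /= !(subsetP lY).
  rewrite cardsX (card_plane (Rd Y YR)) -expnD addnn -mul2n => h.
  rewrite -mulnn; nia.
have : (#|A| <= \sum_(Y in R) #|[set l in A | l \subset Y]|)%N.
  have -> : (\sum_(Y in R) #|[set l in A | l \subset Y]| =
             \sum_(l in A) \sum_(Y in R) (l \subset Y))%N.
    rewrite exchange_big; apply: eq_bigr => Y _ /=.
    rewrite -sum1dep_card big_mkcondr /=; apply: eq_bigr => l _.
    by case: (_ \subset _).
  rewrite -sum1_card; apply: leq_sum => l lA; have [Y YR lY] := AR l lA.
  by rewrite (bigD1 Y) //= lY.
move=> /(leq_mul)/(_ (leqnn (q ^ 2)%N)) h; apply: leq_trans h _.
rewrite big_distrl mulnCA -sum_nat_const /=; exact: leq_sum.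
Qed.

(** Cauchy-Schwarz for the number m(x) of planes through x: its sum over the
    union is at least |R| q^(e+1) / 8, while the sum of its squares is at most
    |R| q^(e+1) + |R|^2 q^e, since distinct planes share at most q^e points. *)
Lemma card_union_planes e (R : {set {set V}}) P :
  {in R, forall Y, is_plane e.+1 Y} ->
  {in R, forall Y, (q ^ e.+1 <= 8 * #|P :&: Y|)%N} ->
  (#|R| * q ^ e.+2 <= 64 * (#|P :&: \bigcup_(Y in R) Y| * (q + #|R|)))%N.
Proof.
move=> Rd Rr; have qgt1 := card_field_gt1 F.
set U := P :&: _.
pose m x := (\sum_(Y in R) (x \in Y))%N.
have dbl : (\sum_(x in U) m x = \sum_(Y in R) #|P :&: Y|)%N.
  rewrite exchange_big; apply: eq_bigr => Y YR /=.
  rewrite -sum1_card [LHS]big_mkcond [RHS]big_mkcond /=; apply: eq_bigr => x _.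
  rewrite [x \in P :&: Y]inE; case: (boolP (x \in Y)) => xY; last first.
    by rewrite andbF if_same.
  have xR : x \in \bigcup_(Z in R) Z by apply/bigcupP; exists Y.
  by rewrite /U [x \in P :&: _]inE xR.
have sq : (\sum_(x in U) m x ^ 2 <= #|R| * q ^ e * (q + #|R|))%N.
  have -> : (\sum_(x in U) m x ^ 2 =
      \sum_(Y in R) \sum_(Z in R) #|U :&: (Y :&: Z)|)%N.
    transitivity (\sum_(x in U) \sum_(Y in R) \sum_(Z in R) (x \in Y) * (x \in Z))%N.
      apply: eq_bigr => x _; rewrite -mulnn big_distrl /=.
      by apply: eq_bigr => Y _; rewrite big_distrr.
    rewrite exchange_big; apply: eq_bigr => Y _; rewrite exchange_big /=.
    apply: eq_bigr => Z _; rewrite -sum1_card [LHS]big_mkcond [RHS]big_mkcond /=.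
    apply: eq_bigr => x _; rewrite [x \in U :&: _]inE [x \in Y :&: _]inE.
    by case: (x \in U); case: (x \in Y); case: (x \in Z).
  rewrite -mulnA -sum_nat_const; apply: leq_sum => Y YR.
  rewrite (bigD1 Y) //= mulnDr; apply: leq_add.
    by rewrite -expnSr -(card_plane (Rd Y YR)) subset_leq_card // setIid subsetIr.
  rewrite mulnC -sum_nat_const [leqRHS](bigD1 Y) //=.
  apply: leq_trans (leq_addl _ _); apply: leq_sum => Z /andP[ZR nZY].
  rewrite -(leq_pmul2l (ltnW qgt1)) -expnS.
  apply: leq_trans (card_planeI (Rd Y YR) (Rd Z ZR) _); last by rewrite eq_sym.
  by rewrite leq_mul2l subset_leq_card ?orbT // subsetIr.
have low : (#|R| * q ^ e.+1 <= 8 * \sum_(x in U) m x)%N.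
  rewrite dbl big_distrr /= -sum_nat_const; exact: leq_sum.
case: (posnP #|R|) => [->|Rgt0]; first by rewrite mul0n.
have Rq : (0 < #|R| * q ^ e)%N by rewrite muln_gt0 Rgt0 expn_gt0 (ltnW qgt1).
rewrite -(leq_pmul2l Rq).
have := leq_mul low low; have := cauchy_schwarz_nat U m.
move: (leq_mul (leqnn #|U|) sq).
rewrite (_ : #|R| * q ^ e.+1 * (#|R| * q ^ e.+1) = 
  #|R| * q ^ e * (#|R| * q ^ e.+2))%N; last by rewrite !expnSr; ring.
move: (\sum_(x in U) m x)%N (\sum_(x in U) m x ^ 2)%N => s s2.
rewrite -mulnn; lia.
Qed.

End RichPlanes.

(** * Real exponents *)

(** The last inequality is where beta < 1 enters: q^(1 - beta) exceeds any given
    constant once q is large. *)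
Lemma exponent_gap (R : realType) (beta K : R) :
  0 <= beta -> beta < 1 -> 1 <= K -> exists M : R, forall q, M <= q ->
  [/\ 16 * K <= q, 1 <= q `^ beta, q `^ beta <= q
    & (128 * K) ^+ 2 * q `^ beta < q].
Proof.
move=> beta0 beta1 K1; pose T := (128 * K) ^+ 2 + 1.
have T0 : 0 <= T by rewrite addr_ge0 ?sqr_ge0.
have gap0 : 0 < 1 - beta by rewrite subr_gt0.
exists (16 * K + T `^ (1 - beta)^-1) => q qM.
have qK : 16 * K <= q by rewrite (le_trans _ qM) // lerDl powR_ge0.
have q1 : 1 <= q by lra.
have q0 : 0 < q by lra.
have b1 : 1 <= q `^ beta by rewrite -[leLHS](powRr0 q) ler_powR.
split=> //; first by rewrite -[leRHS]powRr1 ?(ltW q0) // ler_powR // ltW.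
have qE : q `^ beta * q `^ (1 - beta) = q.
  by rewrite -powRD ?subrKC ?powRr1 ?(ltW q0) // (gt_eqF q0) implybT.
rewrite -[ltRHS]qE mulrC ltr_pM2l ?powR_gt0 //.
apply: (@lt_le_trans _ _ T); first by rewrite ltrDl.
have -> : T = (T `^ (1 - beta)^-1) `^ (1 - beta).
  by rewrite -powRrM mulVf ?lt0r_neq0 // powRr1.
apply: ge0_ler_powR; rewrite ?nnegrE ?powR_ge0 ?(ltW gap0) ?(ltW q0) //.
by rewrite (le_trans _ qM) // lerDr mulr_ge0 // (le_trans _ K1).
Qed.

(** The function N / (q + N) is at least 1/2 when N >= q and at least N / (2q)
    otherwise.  Here w stands for q^d, b for q^beta and u for the size of the
    union. *)
Lemma union_lower_arith (R : realFieldType) (q N u b w : R) :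
  0 < q -> 0 < w -> 0 < b -> 0 <= u -> b <= q -> b <= 4 * N ->
  N * (w * q) <= 64 * (u * (q + N)) -> w * b <= 512 * u.
Proof.
move=> q0 w0 b0 u0 bq bN h; have N0 : 0 < N by lra.
have wbq : w * b <= w * q by rewrite ler_pM2l.
have wbN : w * b <= w * (4 * N) by rewrite ler_pM2l.
have [qN|Nq] := leP q N.
  have : N * (w * q) <= N * (128 * u).
    have : u * (q + N) <= u * (2 * N) by apply: ler_wpM2l => //; lra.
    lra.
  by rewrite ler_pM2l //; lra.
have : q * (w * N) <= q * (128 * u).
  have : u * (q + N) <= u * (2 * q) by apply: ler_wpM2l => //; lra.
  lra.
by rewrite ler_pM2l //; lra.
Qed.

(** * Covering the union by rich planes *)

Theorem theorem1p5 (R : realType) (d : nat) (beta : R)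
    (hd : (1 <= d)%N) (hbeta0 : 0 <= beta) (hbeta1 : beta < 1) :
  forall C : R, exists M c : R, 0 < c /\
  forall (F : finFieldType) (n : nat) (L : {set {set 'rV[F]_n}}),
    M <= #|F|%:R ->
    (0 < n)%N ->
    (forall l : {set 'rV[F]_n}, l \in L -> is_line l) ->
    #|F|%:R `^ (2 * (d%:R - 1) + beta) <= #|L|%:R ->
    let P : {set 'rV[F]_n} := (\bigcup_(l in L) l)%SET in
    #|P|%:R <= C * #|F|%:R `^ (d%:R + beta) ->
    exists (N : nat) (Q : 'I_N -> {set 'rV[F]_n}),
      [/\ injective Q,
          forall j : 'I_N, is_plane d (Q j),
          c * #|F|%:R `^ beta <= N%:R,
          c * #|P|%:R <= #|(P :&: \bigcup_(j < N) Q j)%SET|%:R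
        & forall j : 'I_N, c * #|Q j|%:R <= #|(P :&: Q j)%SET|%:R].
Proof.
move=> C; pose K : R := `|C| + 1.
have K1 : 1 <= K by rewrite /K lerDr.
have K0 : 0 < K := lt_le_trans ltr01 K1.
have CK : C <= K by rewrite /K (le_trans (ler_norm _)) // lerDl.
have [M large] := exponent_gap hbeta0 hbeta1 K1.
(* 512 is the constant of [union_lower_arith]; it dominates the constants 4 and
   8 of the other two bounds. *)
have [D D0 DE] : exists2 D : R, 0 < D & D = 512 by exists 512; rewrite ?ltr0n.
exists M, (D * K)^-1; split; first by rewrite invr_gt0 mulr_gt0.
move=> F n L /large[qK b1 bq gap] _ Ll hL P hP.
have weaken m (s t : R) : 0 <= t -> m <= D -> s <= m * t ->
    (D * K)^-1 * s <= t.
  move=> t0 mD st; rewrite ler_pdivrMl ?mulr_gt0 //; apply: le_trans st _.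
  by apply: ler_wpM2r => //; apply: le_trans mD _; rewrite ler_peMr ?(ltW D0).
case: d hd hL hP => // e _ hL hP.
set q : R := #|F|%:R in qK b1 bq gap hL hP *.
set b := q `^ beta in b1 bq gap *; pose p : R := #|P|%:R.
have q16 : 16 <= q by apply: le_trans qK; rewrite ler_peMr.
have q0 : 0 < q by apply: lt_le_trans q16.
have b0 : 0 < b by apply: lt_le_trans b1.
have hL' : q ^+ (2 * e) * b <= #|L|%:R.
  apply: le_trans hL; rewrite powRD; last by rewrite (gt_eqF q0) implybT.
  by rewrite -[e.+1%:R]natr1 addrK -natrM powR_mulrn ?(ltW q0).
have hP' : p <= K * (q ^+ e.+1 * b).
  apply: le_trans hP _; rewrite powRD; last by rewrite (gt_eqF q0) implybT.
  rewrite powR_mulrn ?(ltW q0) // ler_wpM2r //.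
  by rewrite mulr_ge0 ?exprn_ge0 ?(ltW q0) // ltW.
have LP : {in L, forall l : {set 'rV[F]_n}, l \subset P}.
  by move=> l lL; apply: (@finset.bigcup_sup _ _ l).
have Ll' : {in L, forall l, is_line l} by move=> l /Ll.
have [A [AL LA AY]] : exists A : {set {set 'rV[F]_n}},
    [/\ A \subset L, (#|L| <= 2 * #|A|)%N &
      {in A, forall l : {set 'rV[F]_n}, exists Y : {set 'rV[F]_n},
        [/\ is_plane e.+1 Y, l \subset Y & (#|F| ^ e.+1 <= 8 * #|(P :&: Y)%SET|)%N]}].
  (* In dimension 1 the lines themselves are the planes. *)
  case: e hL' hP' {hL hP} => [|e] hL' hP'.
    exists L; split => // [|l lL]; first by rewrite leq_pmull.
    exists l; split; [exact: Ll | by [] |].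
    rewrite (finset.setIidPr (LP l lL)) (card_plane (Ll l lL)).
    by rewrite leq_pmull.
  apply: lines_in_rich_planes => //.
  - by rewrite -(ler_nat R) -/q (le_trans _ q16) // ler_nat.
  - rewrite -(ler_nat R) !natrM natrX -/q -/p.
    have : #|L|%:R * q >= q ^+ (2 * e.+1) * b * q by rewrite ler_pM2r.
    apply: le_trans.
    have -> : q ^+ (2 * e.+1) * b * q = q * (q ^+ e.+2 * b * q ^+ e).
      by rewrite mul2n -addnn !exprD !exprS; ring.
    apply: (@le_trans _ _ (16 * (K * (q ^+ e.+2 * b) * q ^+ e))).
      by rewrite ler_pM2l // ler_pM2r // exprn_gt0.
    rewrite -(mulrA K) (mulrA 16); apply: ler_wpM2r => //.
    exact: ltW (mulr_gt0 (mulr_gt0 (exprn_gt0 _ q0) b0) (exprn_gt0 _ q0)).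
  - rewrite -(ltr_nat R) [_%:R](natrX R (128 * _)%N 2).
    rewrite (natrM _ 128) (natrM _ #|L|) (natrX R #|F| 3) -/q -/p.
    have : #|L|%:R * q ^+ 3 >= q ^+ (2 * e.+1) * b * q ^+ 3 by rewrite ler_pM2r ?exprn_gt0.
    move=> Lq; apply: lt_le_trans Lq.
    have -> : q ^+ (2 * e.+1) * b * q ^+ 3 = q * (b * (q ^+ e.+2) ^+ 2).
      by rewrite mul2n -addnn !exprD !exprS; ring.
    apply: (@le_lt_trans _ _ ((128 * (K * (q ^+ e.+2 * b))) ^+ 2)).
      have p0 : 0 <= p by exact: ler0n.
      rewrite lerXn2r ?nnegrE ?(mulr_ge0 (ler0n _ _)) ?(le_trans p0 hP') //.
      exact: ler_wpM2l (ler0n _ _) _ _ hP'.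
    have -> : (128 * (K * (q ^+ e.+2 * b))) ^+ 2 =
              ((128 * K) ^+ 2 * b) * (b * (q ^+ e.+2) ^+ 2) by ring.
    by rewrite ltr_pM2r // (mulr_gt0 b0) // !exprn_gt0.
pose RR : {set {set 'rV[F]_n}} :=
  [set Y | `[< is_plane e.+1 Y >] && (#|F| ^ e.+1 <= 8 * #|(P :&: Y)%SET|)%N]%SET.
have RRp : {in RR, forall Y : {set 'rV[F]_n}, is_plane e.+1 Y}.
  by move=> Y; rewrite finset.inE => /andP[/asboolP].
have RRr : {in RR, forall Y : {set 'rV[F]_n}, (#|F| ^ e.+1 <= 8 * #|(P :&: Y)%SET|)%N}.
  by move=> Y; rewrite finset.inE => /andP[_].
have AR : {in A, forall l : {set 'rV[F]_n},
    exists2 Y : {set 'rV[F]_n}, Y \in RR & l \subset Y}.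
  move=> l /AY[Y [pY lY rY]]; exists Y => //.
  by rewrite finset.inE rY andbT; apply/asboolP.
have Al : {in A, forall l, is_line l} by move=> l /(fintype.subsetP AL) /Ll.
pose N : R := #|RR|%:R.
have Nb : b <= 4 * N.
  have := many_planes RRp Al AR; rewrite -(ler_nat R) (natrM _ #|A|).
  rewrite (natrM _ 2) (natrM _ #|RR|) !natrX -/q -/N => h1.
  have h2 : #|L|%:R <= 2 * #|A|%:R :> R by rewrite -natrM ler_nat.
  have h3 : q ^+ (2 * e) * b * q ^+ 2 <= 2 * #|A|%:R * q ^+ 2.
    by rewrite ler_pM2r ?exprn_gt0 // (le_trans hL').
  have h4 : q ^+ (2 * e.+1) * b <= q ^+ (2 * e.+1) * (4 * N).
    have qE : q ^+ (2 * e.+1) = q ^+ (2 * e) * q ^+ 2 by rewrite mulnS addnC exprD.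
    rewrite qE in h1 *; clear - h1 h3; lra.
  by move: h4; rewrite ler_pM2l ?exprn_gt0.
pose U := (P :&: \bigcup_(Y in RR) Y)%SET; pose u : R := #|U|%:R.
have u0 : 0 <= u by exact: ler0n.
have Uge : q ^+ e.+1 * b <= D * u.
  rewrite DE.
  apply: (union_lower_arith (q := q) (N := N)); rewrite ?exprn_gt0 //.
  have := card_union_planes RRp RRr; rewrite -/U -(ler_nat R) (natrM _ #|RR|).
  by rewrite (natrM _ 64) (natrM _ #|U|) natrD natrX exprSr.
exists #|RR|, (fun j => enum_val j); split.
- exact: enum_val_inj.
- by move=> j; apply: RRp; exact: enum_valP.
- by apply: (weaken 4); rewrite ?ler0n ?DE ?ler_nat.
- rewrite -(big_enum_val (fun Y : {set 'rV[F]_n} => Y)) -/U -/p -/u.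
  rewrite ler_pdivrMl ?mulr_gt0 //; apply: le_trans hP' _.
  by rewrite [D * K]mulrC -mulrA ler_pM2l.
- move=> j; have jR : enum_val j \in RR by exact: enum_valP.
  apply: (weaken 8); rewrite ?ler0n ?DE ?ler_nat // -natrM ler_nat.
  by rewrite (card_plane (RRp _ jR)) RRr.
Qed.
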